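(* Let $(X,d)$ be a compact metric space, let $f\colon X\to X$ be a continuous map, and let $Q=\{q_i\}_{i\ge 0}$ be a strictly increasing sequence of positive integers tending to infinity. Suppose there exists $M$ such that $q_{i+1}-q_i\le M$ for all $i$. Then $f$ is distributionally chaotic if and only if $f$ is distributionally chaotic in the sequence $Q$.
   Context: Let $(X,d)$ be a metric space and $f\colon X\to X$ continuous; $f^n$ denotes the $n$-fold iterate of $f$ and $\#$ denotes cardinality. For $x,y\in X$ and $t>0$ put $$F(f,x,y,t)=\liminf_{n\to\infty}\frac1n\#\{i : d(f^i(x),f^i(y))<t,\ 0\le i<n\},$$ $$F^*(f,x,y,t)=\limsup_{n\to\infty}\frac1n\#\{i : d(f^i(x),f^i(y))<t,\ 0\le i<n\}.$$ The map $f$ is distributionally chaotic if there exists an uncountable subset $S\subseteq X$ such that for every pair $x,y\in S$ of distinct points, $F(f,x,y,\varepsilon)=0$ for some $\varepsilon>0$ and $F^*(f,x,y,t)=1$ for all $t>0$. For a strictly increasing sequence $Q=\{q_i\}_{i\ge0}$ of positive integers put $$F(f,x,y,t,q_i)=\liminf_{n\to\infty}\frac1n\#\{i : d(f^{q_i}(x),f^{q_i}(y))<t,\ 0\le i<n\},$$ $$F^*(f,x,y,t,q_i)=\limsup_{n\to\infty}\frac1n\#\{i : d(f^{q_i}(x),f^{q_i}(y))<t,\ 0\le i<n\}.$$ The map $f$ is distributionally chaotic in the sequence $Q$ if there exists an uncountable subset $S\subseteq X$ such that for every pair $x,y\in S$ of distinct points, $F(f,x,y,\varepsilon,q_i)=0$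 for some $\varepsilon>0$ and $F^*(f,x,y,t,q_i)=1$ for all $t>0$. *)

(* Defs.v *)
From HB Require Import structures.
From mathcomp Require Import all_boot all_order all_algebra.
From mathcomp Require Import all_classical all_reals all_analysis.

Set Implicit Arguments.
Unset Strict Implicit.
Unset Printing Implicit Defensive.

Import Order.TTheory GRing.Theory Num.Theory.
Import numFieldTopology.Exports numFieldNormedType.Exports.

Local Open Scope classical_set_scope.
Local Open Scope ring_scope.

(* #{i : A i, 0 <= i < n} / n; its value at n = 0, where n%:R^-1 = 0, is 0 and
   is irrelevant to the limits below. *)
Definition freq (R : realType) (A : pred nat) (n : nat) : R :=
  #|[pred i : 'I_n | A i]|%:R / n%:R.

(* [freq R A] takes its values in [0, 1], so the real-valued [limn_inf] and
   [limn_sup] are limits of convergent sequences here. *)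
Definition lower_density (R : realType) (A : pred nat) : R :=
  limn_inf (freq R A).

Definition upper_density (R : realType) (A : pred nat) : R :=
  limn_sup (freq R A).

Definition dist_lower (R : realType) (X : metricType R) (f : X -> X) (x y : X)
    (t : R) : R :=
  lower_density R (fun i => mdist (iter i f x) (iter i f y) < t).

Definition dist_upper (R : realType) (X : metricType R) (f : X -> X) (x y : X)
    (t : R) : R :=
  upper_density R (fun i => mdist (iter i f x) (iter i f y) < t).

Definition dist_chaotic (R : realType) (X : metricType R) (f : X -> X) : Prop :=
  exists S : set X, ~ countable S /\
    forall x y : X, S x -> S y -> x <> y ->
      (exists e : R, 0 < e /\ dist_lower f x y e = 0) /\
      (forall t : R, 0 < t -> dist_upper f x y t = 1).

Definition dist_lower_seq (R : realType) (X : metricType R) (f : X -> X)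
    (x y : X) (t : R) (q : nat -> nat) : R :=
  lower_density R (fun i => mdist (iter (q i) f x) (iter (q i) f y) < t).

Definition dist_upper_seq (R : realType) (X : metricType R) (f : X -> X)
    (x y : X) (t : R) (q : nat -> nat) : R :=
  upper_density R (fun i => mdist (iter (q i) f x) (iter (q i) f y) < t).

Definition dist_chaotic_seq (R : realType) (X : metricType R) (f : X -> X)
    (q : nat -> nat) : Prop :=
  exists S : set X, ~ countable S /\
    forall x y : X, S x -> S y -> x <> y ->
      (exists e : R, 0 < e /\ dist_lower_seq f x y e q = 0) /\
      (forall t : R, 0 < t -> dist_upper_seq f x y t q = 1).

(* Main.v *)
Require Import Defs.
From mathcomp Require Import all_boot all_order all_algebra.
From mathcomp Require Import all_classical all_reals all_analysis.
From mathcomp Require Import zify lra.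

Import Order.TTheory GRing.Theory Num.Theory.
Import numFieldTopology.Exports numFieldNormedType.Exports.

Local Open Scope classical_set_scope.
Local Open Scope ring_scope.

(** The same scrambled set serves both notions of chaos, because each of the two
    conditions on a pair of points says that some set of times has arbitrarily small
    frequency along arbitrarily long initial segments: for the lower density being 0
    it is the set of times at which the orbits are close
    ([lower_density_eq0P]), for the upper density being 1 it is the complementary
    set ([upper_density_eq1P]). Call such a set of times recurrently sparse. The
    theorem compares the recurrent sparseness of a set A of times with that of its
    samples, the indices i with q i in A.

    From A to its samples nothing but counting is involved: since q is injective, the
    number of i < m with q i in A is at most the number of elements of A below q m,
    and q m is at most linear in m, so frequencies grow by a bounded factor only
    ([recurrently_sparse_sample]).

    Conversely, cut the times from q 0 on into the blocks [q i, q (i+1)), of length at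
    most M. Compactness gives, for every t, a threshold s such that points at distance
    less than s have their first M iterates at distance less than t
    ([equicontinuous_iterates]). Hence if the orbits are s-close somewhere in a block
    they are t-close at its right end, and if they fail to be t-close somewhere in a
    block they fail to be s-close at its left end. Either way an element of the
    original set of times in a block is witnessed by an endpoint of that block, at the
    price of changing the threshold; an endpoint belongs to at most two blocks, so
    frequencies again grow by a bounded factor only ([recurrently_sparse_window]).
    The change of threshold is harmless since one condition asks for some
    threshold and the other for all. *)

(** * Counting, and recurrently sparse sets of times *)

Definition hits (A : pred nat) (n : nat) : nat := (\sum_(i < n) A i)%N.

Lemma hits0 (A : pred nat) : hits A 0 = 0%N.
Proof. exact: big_ord0. Qed.

Lemma hitsS (A : pred nat) (n : nat) : hits A n.+1 = (hits A n + A n)%N.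
Proof. by rewrite /hits big_ord_recr. Qed.

Lemma leq_hits_size (A : pred nat) (n : nat) : (hits A n <= n)%N.
Proof. by elim: n => [|n IH]; rewrite ?hits0 ?hitsS//; case: (A n) => /=; lia. Qed.

Lemma hitsC (A : pred nat) (n : nat) : (hits A n + hits (predC A) n)%N = n.
Proof.
by elim: n => [|n IH]; rewrite ?hits0// !hitsS /=; case: (A n) => /=; lia.
Qed.

Lemma leq_hits (A : pred nat) (m n : nat) : (m <= n)%N -> (hits A m <= hits A n)%N.
Proof.
elim: n => [|n IH]; first by rewrite leqn0 => /eqP ->.
rewrite leq_eqVlt => /orP[/eqP -> //|/IH]; rewrite hitsS; lia.
Qed.

(** The frequency of [A] has limit inferior 0, phrased with natural numbers
    only ([recurrently_sparseP]): sampling arguments then become inequalities in [nat]. *)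
Definition recurrently_sparse (A : pred nat) : Prop :=
  forall K N : nat, exists2 n, (N <= n)%N & (K * hits A n <= n)%N.

(** * Extreme densities as recurrent sparseness *)

Section densities.
Variable R : realType.
Implicit Types (u : nat -> R) (A : pred nat).

(** As 0 is a lower bound, the limit inferior vanishes exactly when no tail of [u]
    has a positive infimum. *)
Lemma limn_inf_eq_minP u : (forall n, 0 <= u n <= 1) ->
  limn_inf u = 0 <->
  forall (e : R) (N : nat), 0 < e -> exists2 n, (N <= n)%N & u n < e.
Proof.
move=> u01.
have lb N : has_lbound (sdrop u N) by exists 0 => _ [n _ <-]; case/andP: (u01 n).
have nonempty N : sdrop u N !=set0 by exists (u N); exists N => /=.
have ub : has_ubound (range (infs u)).
  exists 1 => _ [N _ <-]; apply: (@le_trans _ _ (u N)); last by case/andP: (u01 N).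
  by apply: ge_inf => //; exists N => /=.
have -> : limn_inf u = sup (range (infs u)).
  by apply/cvg_lim => //; apply: cvg_infs_sup;
    [exists 1|exists 0] => _ [n _ <-]; case/andP: (u01 n).
have infs_ge0 N : 0 <= infs u N.
  by apply: lb_le_inf => // _ [n _ <-]; case/andP: (u01 n).
split=> [sup0 e N e0|often].
  have /(inf_lt (nonempty N)) [_ [n /= Nn <-] une] : infs u N < e.
    by apply: le_lt_trans e0; rewrite -sup0; apply: ub_le_sup => //; exists N.
  by exists n.
apply/eqP; rewrite eq_le; apply/andP; split.
  apply: ge_sup; first by exists (infs u 0%N); exists 0%N.
  move=> _ [N _ <-]; apply/ler_addgt0Pl => e e0; rewrite addr0.
  have [n Nn une] := often e N e0; apply: le_trans (ltW une).
  by apply: ge_inf => //; exists n.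
by apply: le_trans (infs_ge0 0%N) _; apply: ub_le_sup => //; exists 0%N.
Qed.

Lemma limn_sup_eq_maxP u : (forall n, 0 <= u n <= 1) ->
  limn_sup u = 1 <->
  forall (e : R) (N : nat), 0 < e -> exists2 n, (N <= n)%N & 1 - u n < e.
Proof.
move=> u01.
have ub N : has_ubound (sdrop u N) by exists 1 => _ [n _ <-]; case/andP: (u01 n).
have nonempty N : sdrop u N !=set0 by exists (u N); exists N => /=.
have lb : has_lbound (range (sups u)).
  exists 0 => _ [N _ <-]; apply: (@le_trans _ _ (u N)); first by case/andP: (u01 N).
  by apply: ub_le_sup => //; exists N => /=.
have -> : limn_sup u = inf (range (sups u)).
  by apply/cvg_lim => //; apply: cvg_sups_inf;
    [exists 1|exists 0] => _ [n _ <-]; case/andP: (u01 n).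
have sups_le1 N : sups u N <= 1.
  by apply: ge_sup => // _ [n _ <-]; case/andP: (u01 n).
split=> [inf1 e N e0|often].
  have /(sup_gt (nonempty N)) [_ [n /= Nn <-] une] : 1 - e < sups u N.
    apply: (@lt_le_trans _ _ 1); first by rewrite gtrBl.
    by rewrite -{1}inf1; apply: ge_inf => //; exists N.
  by exists n => //; lra.
apply/eqP; rewrite eq_le; apply/andP; split.
  by apply: le_trans (sups_le1 0%N); apply: ge_inf => //; exists 0%N.
apply: lb_le_inf; first by exists (sups u 0%N); exists 0%N.
move=> _ [N _ <-]; apply/ler_addgt0Pl => e e0.
have [n Nn une] := often e N e0; apply: (@le_trans _ _ (e + u n)); first lra.
by rewrite lerD2l; apply: ub_le_sup => //; exists n.
Qed.

Lemma freqE A n : freq R A n = (hits A n)%:R / n%:R.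
Proof.
by rewrite /freq /hits -sum1_card big_mkcond; congr (_%:R / _); apply: eq_bigr => i _;
  rewrite inE; case: (A i).
Qed.

Lemma freq_bounds A n : 0 <= freq R A n <= 1.
Proof.
rewrite freqE divr_ge0//=; case: n => [|n]; first by rewrite invr0 mulr0.
by rewrite ler_pdivrMr ?ltr0n// mul1r ler_nat leq_hits_size.
Qed.

(** The case [n = 0] is excluded because both frequencies are then 0. *)
Lemma freqC A n : (0 < n)%N -> 1 - freq R A n = freq R (predC A) n.
Proof.
move=> n0; have nN0 : n%:R != 0 :> R by rewrite pnatr_eq0 -lt0n.
by rewrite !freqE -{1}(divff nN0) -{1}(hitsC A n) natrD mulrDl addrC addKr.
Qed.

(** The strict bound [N < n] discards [n = 0], where the frequency is 0 by convention
    and would make the right-hand side carry no information for [N = 0]; it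
    is also what [freqC] requires. *)
Lemma recurrently_sparseP A :
  recurrently_sparse A <->
  forall (e : R) (N : nat), 0 < e -> exists2 n, (N < n)%N & freq R A n < e.
Proof.
split=> [sparse e N e0|often K N].
  have [n Nn Kn] := sparse (Num.bound e^-1) N.+1; exists n => //.
  have n0 : 0 < n%:R :> R by rewrite ltr0n; lia.
  rewrite freqE ltr_pdivrMr//.
  have eK : e^-1 < (Num.bound e^-1)%:R by apply: archi_boundP; rewrite invr_ge0 ltW.
  have [->|h0] := posnP (hits A n); first by rewrite mulr_gt0.
  move: Kn; rewrite -(ler_nat R) natrM -ltr_pdivrMl//; apply: lt_le_trans.
  by rewrite ltr_pM2r// ltr0n.
have [|n Nn] := often K.+1%:R^-1 N; first by rewrite invr_gt0 ltr0n.
have n0 : 0 < n%:R :> R by rewrite ltr0n; lia.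
rewrite freqE ltr_pdivrMr// ltr_pdivlMl ?ltr0n// -natrM ltr_nat => h.
exists n; nia.
Qed.

Lemma lower_density_eq0P A : lower_density R A = 0 <-> recurrently_sparse A.
Proof.
rewrite recurrently_sparseP /lower_density limn_inf_eq_minP; last exact: freq_bounds.
split=> H e N e0; last by have [n /ltnW] := H e N e0; exists n.
by have [n] := H e N.+1 e0; exists n.
Qed.

Lemma upper_density_eq1P A : upper_density R A = 1 <-> recurrently_sparse (predC A).
Proof.
rewrite recurrently_sparseP /upper_density limn_sup_eq_maxP; last exact: freq_bounds.
split=> H e N e0.
  by have [n Nn] := H e N.+1 e0; rewrite freqC ?(leq_ltn_trans _ Nn)//; exists n.
by have [n Nn] := H e N e0; exists n; rewrite ?freqC ?(leq_ltn_trans _ Nn)// ltnW.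
Qed.

End densities.

(** * Sampling along a sequence with bounded gaps *)

Section sampling.
Variables (q : nat -> nat) (M : nat).
Hypothesis q_incr : {homo q : i j / (i < j)%N}.
Hypothesis q_gap : forall i, (q i.+1 - q i <= M)%N.
Implicit Types A B : pred nat.

Lemma leq_sample m : (m <= q m)%N.
Proof. by elim: m => // m /leq_ltn_trans; apply; exact: q_incr. Qed.

Lemma leq_sample_mono i j : (i <= j)%N -> (q i <= q j)%N.
Proof. by rewrite leq_eqVlt => /orP[/eqP -> //|/q_incr/ltnW]. Qed.

Lemma sample_le_linear m : (q m <= q 0 + M * m)%N.
Proof. by elim: m => [|m IH]; [lia|have := q_gap m; nia]. Qed.

Lemma hits_sample_le A m : (hits (A \o q) m <= hits A (q m))%N.
Proof.
elim: m => [|m IH]; first by rewrite hits0.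
have : (hits A (q m).+1 <= hits A (q m.+1))%N by apply: leq_hits; exact: q_incr.
by rewrite !hitsS /=; lia.
Qed.

(** Round a good length [n] down to [q m]: the samples below [m] number at most the
    elements of [A] below [n], while [n < q m.+1] is at most linear in [m]. *)
Lemma recurrently_sparse_sample A :
  recurrently_sparse A -> recurrently_sparse (A \o q).
Proof.
move=> sparse K N.
(* The factor [q 0 + 2 M + 1] bounds [q m.+1 / m] for [m >= 1], hence [n / m] below. *)
have [n qn Kn] := sparse (K * (q 0 + M.*2).+1)%N (q N.+1).
have [m qmn nqm] : exists2 m, (q m <= n)%N & (n < q m.+1)%N.
  have bound i : (q i <= n)%N -> (i <= n)%N by have := leq_sample i; lia.
  case: (@ex_maxnP (fun i => (q i <= n)%N) n) => [|//|m qm maxm].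
    by exists N.+1.
  by exists m => //; rewrite ltnNge; apply/negP => /maxm; rewrite ltnn.
have Nm : (N < m)%N.
  have := leq_sample_mono m.+1 N.+1; case: (ltnP N m) => //; lia.
exists m; first exact: ltnW.
set c := (q 0 + M.*2).+1 in Kn *; suff: (c * (K * hits (A \o q) m) <= c * m)%N.
  by rewrite leq_pmul2l.
apply: (@leq_trans n).
  apply: leq_trans Kn; rewrite mulnA (mulnC c) leq_mul2l; apply/orP; right.
  exact: leq_trans (hits_sample_le A m) (leq_hits _ _ _ qmn).
apply: leq_trans (ltnW nqm) _; apply: leq_trans (sample_le_linear _) _.
by rewrite /c; nia.
Qed.

(** A block contains at most [M] elements of [A], and none unless one of its two ends
    lies in [B]; each [q i] is an end of at most two blocks, whence the factor 2. The
    term [q 0] covers the times before the first block. *)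
Lemma hits_window A B m :
  (forall i k, (q i <= k < q i.+1)%N -> A k -> B (q i) || B (q i.+1)) ->
  (hits A (q m) <= q 0 + M.*2 * hits (B \o q) m.+1)%N.
Proof.
move=> window.
have block i k : (k <= M)%N -> (q i + k <= q i.+1)%N ->
    (hits A (q i + k) <= hits A (q i) + k * (B (q i) + B (q i.+1)))%N.
  elim: k => [|k IH] kM kq; first by rewrite addn0 mul0n addn0.
  rewrite addnS hitsS.
  have := window i (q i + k)%N; case: (A _) => /=; last by have := IH; lia.
  by move=> /(_ _ isT); have := IH; case: (B (q i)); case: (B (q i.+1)) => /=; lia.
(* The right end [q m] has been charged for one block only, so its second charge
   is still available: this is what carries the induction through. *)
suff : (hits A (q m) + M * B (q m) <= q 0 + M.*2 * hits (B \o q) m.+1)%N by lia.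
elim: m => [|m IH].
  by have := leq_hits_size A (q 0%N); rewrite hitsS hits0 /=; nia.
have lt_q := q_incr m m.+1 (ltnSn m).
have := block m (q m.+1 - q m)%N (q_gap m); rewrite subnKC; last exact: ltnW.
rewrite leqnn => /(_ isT); rewrite [hits (B \o q) m.+2]hitsS /=.
have := q_gap m; nia.
Qed.

(** Converse of [recurrently_sparse_sample], up to replacing [A] by a set [B] that
    catches each element of [A] at an end of its block. In the application
    [A] and [B] come from two closeness thresholds. *)
Lemma recurrently_sparse_window A B :
  (forall i k, (q i <= k < q i.+1)%N -> A k -> B (q i) || B (q i.+1)) ->
  recurrently_sparse (B \o q) -> recurrently_sparse A.
Proof.
move=> window sparse K N.
(* Half of [m] absorbs the constant [K * q 0], the other half the sampled hits; hence
   twice [K * 2 M] and a lower bound on [n] beyond [2 * (K * q 0)]. *)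
have [n Nn Kn] := sparse (4 * M * K)%N (N + (K * q 0).*2).+2.
case: n => // m in Nn Kn *; exists (q m); first by have := leq_sample m; lia.
have := hits_window A B m window; have := leq_sample m; nia.
Qed.

End sampling.

(** * Uniform continuity of the first iterates, and the theorem *)

(** Heine's theorem for finitely many iterates at once: a continuity radius [r] of
    the first [M] iterates at a point [x] works, once halved, at all points close to
    [x], and compactness makes one radius work everywhere. *)
Lemma equicontinuous_iterates (R : realType) (X : metricType R) (f : X -> X)
    (M : nat) (t : R) : compact [set: X] -> continuous f -> 0 < t ->
  exists2 s : R, 0 < s & forall (x y : X) (j : nat), (j <= M)%N ->
    mdist x y < s -> mdist (iter j f x) (iter j f y) < t.
Proof.
move=> cptX cf t0; have t20 : 0 < t / 2 by lra.
have ball_mdist (x y : X) r : ball x r y = (mdist x y < r) :> Prop.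
  by rewrite ballEmdist.
have citer j : continuous (iter j f).
  by elim: j => [|j IH] x /=; [exact: cvg_id|exact: (continuous_comp (IH x) (cf _))].
have local (x : X) : exists2 r : R, 0 < r & forall y j, (j <= M)%N ->
    ball x r y -> ball (iter j f x) (t / 2) (iter j f y).
  elim: M => [|m [r r0 IH]].
    by exists (t / 2) => // y j; rewrite leqn0 => /eqP ->.
  have /nbhs_ballP[r' /= r'0 Hr'] := citer m.+1 x _ (nbhsx_ballx _ _ t20).
  exists (Num.min r r') => [|y j]; first by rewrite lt_min r0.
  rewrite ball_mdist lt_min => + /andP[yr yr'].
  rewrite leq_eqVlt => /orP[/eqP ->|/IH]; last by apply; rewrite ball_mdist.
  by apply: (Hr' y); rewrite ball_mdist.
have /compact_near_coveringP cover := cptX.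
have near_unif : \forall s \near (0 : R)^'+, [set: X] `<=` (fun x => forall y j,
    (j <= M)%N -> mdist x y < s -> mdist (iter j f x) (iter j f y) < t).
  apply: (cover R (0^'+) (fun s x => forall y j, (j <= M)%N ->
    mdist x y < s -> mdist (iter j f x) (iter j f y) < t)) => x _.
  have [r r0 Hr] := local x; have r20 : 0 < r / 2 by lra.
  near=> x' s => y j jM x'y.
  have xx' : ball x (r / 2) x' by near: x'; exact: nbhsx_ballx.
  have /ltW sr : s < r / 2 by near: s; exact: nbhs_right_lt.
  rewrite -ball_mdist; apply: (@ball_splitr _ _ (iter j f x)).
    by apply: (Hr x' j jM); apply: le_ball xx'; lra.
  apply: (Hr y j jM); apply: ball_split xx' _; rewrite ball_mdist.
  exact: lt_le_trans sr.
near (0 : R)^'+ => s; exists s => [|x y j].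
  by near: s; exact: nbhs_right_gt.
by apply: (near near_unif s _).
Unshelve. all: by end_near. Qed.

Theorem theorem1 (R : realType) (X : metricType R) (f : X -> X)
    (q : nat -> nat) :
  compact [set: X] ->
  continuous f ->
  (forall i : nat, (0 < q i)%N) ->
  {homo q : i j / (i < j)%N} ->
  q @ \oo --> \oo ->
  (exists M : nat, forall i : nat, (q i.+1 - q i <= M)%N) ->
  dist_chaotic f <-> dist_chaotic_seq f q.
Proof.
move=> cptX cf _ q_incr _ [M q_gap].
split=> -[S [S_unctbl chaosS]]; exists S; split=> // x y Sx Sy xy;
  have [[e [e0 /lower_density_eq0P low]] upp] := chaosS x y Sx Sy xy; split.
(* Sampling keeps the thresholds; the converse direction loses some closeness. *)
- exists e; split=> //; apply/lower_density_eq0P.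
  exact: (recurrently_sparse_sample q M q_incr q_gap _ low).
- move=> t t0; apply/upper_density_eq1P.
  have /upper_density_eq1P sparse := upp t t0.
  exact: (recurrently_sparse_sample q M q_incr q_gap _ sparse).
- have [s s0 close] := equicontinuous_iterates R X f M e cptX cf e0.
  exists s; split=> //; apply/lower_density_eq0P.
  pose near_e k := mdist (iter k f x) (iter k f y) < e.
  apply: (recurrently_sparse_window q M q_incr q_gap _ near_e _ low) => i k /andP[ik ki].
  have jM : (q i.+1 - k <= M)%N by have := q_gap i; lia.
  move=> close_s; apply/orP; right.
  by have := close _ _ _ jM close_s; rewrite -!iterD subnK // ltnW.
- move=> t t0; apply/upper_density_eq1P.
  have [s s0 close] := equicontinuous_iterates R X f M t cptX cf t0.
  have /upper_density_eq1P sparse := upp s s0.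
  pose far_s k := ~~ (mdist (iter k f x) (iter k f y) < s).
  apply: (recurrently_sparse_window q M q_incr q_gap _ far_s _ sparse) => i k /andP[ik ki].
  have jM : (k - q i <= M)%N by have := q_gap i; lia.
  move=> /negP not_close; apply/orP; left; apply/negP => close_start; apply: not_close.
  by have := close _ _ _ jM close_start; rewrite -!iterD subnK.
Qed.
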